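(* Let $R$ be a nonzero ring and let $G$ be a group. Then the group ring $RG$ is $\sqrt{\Delta}$-fine if and only if $R$ is $\sqrt{\Delta}$-fine and $G$ is the trivial group.
   Context: Rings are associative with identity, not necessarily commutative. For a ring $R$, $U(R)$ is its group of units. Define $\Delta(R) = \{a \in R : 1 - ua \in U(R) \text{ for every } u \in U(R)\}$ and $\sqrt{\Delta(R)} = \{x \in R : x^m \in \Delta(R) \text{ for some integer } m \ge 1\}$. A nonzero element $r \in R$ is called $\sqrt{\Delta}$-fine if $r = u + a$ for some $u \in U(R)$ and $a \in \sqrt{\Delta(R)}$. The ring $R$ is called $\sqrt{\Delta}$-fine if every nonzero element of $R$ is $\sqrt{\Delta}$-fine. $RG$ denotes the group ring of $G$ over $R$. *)

(* Defs.v *)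
From HB Require Import structures.
From mathcomp Require Import all_boot all_order all_algebra.
From mathcomp Require Import finmap.
From mathcomp.multinomials Require Import monalg.

Set Implicit Arguments.
Unset Strict Implicit.
Unset Printing Implicit Defensive.

Import GRing.Theory.
Local Open Scope ring_scope.

(* A ring here need not come with a decidable set of units (as a
   [unitRingType] does), so being a unit is a proposition. *)
Definition is_unit (A : pzRingType) (x : A) : Prop :=
  exists y : A, x * y = 1 /\ y * x = 1.

Definition Delta (A : pzRingType) (a : A) : Prop :=
  forall u : A, is_unit u -> is_unit (1 - u * a).

Definition sqrtDelta (A : pzRingType) (x : A) : Prop :=
  exists m : nat, (1 <= m)%N /\ Delta (x ^+ m).

Definition sqrtDelta_fine_elt (A : pzRingType) (r : A) : Prop :=
  r <> 0 /\ exists u a : A, [/\ is_unit u, sqrtDelta a & r = u + a].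

Definition sqrtDelta_fine (A : pzRingType) : Prop :=
  forall r : A, r <> 0 -> sqrtDelta_fine_elt r.

(* Elements of the group ring are the finitely supported functions G -> R,
   with the additive structure of [{malg R[G]}].  The library multiplies in
   [{malg R[K]}] only for K a [monomType], a monoid in which x * y = 1 forces
   x = y = 1; that excludes nontrivial groups, hence the alias below with its
   own ring structure. *)
Definition group_ring (R : nzRingType) (G : groupType) : Type := {malg R[G]}.

HB.instance Definition _ (R : nzRingType) (G : groupType) :=
  GRing.Zmodule.copy (group_ring R G) {malg R[G]}.

Section GroupRing.
Context (R : nzRingType) (G : groupType).
Implicit Types (x y z : {malg R[G]}) (g h : G) (a b : R).

Definition grone : {malg R[G]} := << 1 *g 1%g >>.

Definition grmul x y : {malg R[G]} :=
  \sum_(g <- msupp x) \sum_(h <- msupp y) << x@_g * y@_h *g (g * h)%g >>.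

Lemma grmulw (d1 d2 : {fset G}) x y :
    (msupp x `<=` d1)%fset -> (msupp y `<=` d2)%fset ->
  grmul x y = \sum_(g <- d1) \sum_(h <- d2) << x@_g * y@_h *g (g * h)%g >>.
Proof.
move=> le1 le2; rewrite /grmul (big_fset_incl _ le1) /=.
  apply/eq_bigr=> g _; apply/big_fset_incl => // h _ /mcoeff_outdom ->.
  by rewrite mulr0 monalgU0.
move=> g _ /mcoeff_outdom xg.
by rewrite big1 // => h _; rewrite xg mul0r monalgU0.
Qed.

Lemma grmul0l : left_zero 0 grmul.
Proof. by move=> x; rewrite /grmul msupp0 big_seq_fset0. Qed.

Lemma grmul0r : right_zero 0 grmul.
Proof.
by move=> x; rewrite /grmul big1 // => g _; rewrite msupp0 big_seq_fset0.
Qed.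

Lemma grmulDl : left_distributive grmul +%R.
Proof.
move=> x y z.
rewrite (grmulw (msuppD_le x y) (fsubset_refl _)).
rewrite (grmulw (fsubsetUl _ (msupp y)) (fsubset_refl (msupp z))).
rewrite (grmulw (fsubsetUr (msupp x) _) (fsubset_refl (msupp z))).
rewrite -big_split /=; apply/eq_bigr=> g _.
rewrite -big_split /=; apply/eq_bigr=> h _.
by rewrite mcoeffD mulrDl monalgUD.
Qed.

Lemma grmulDr : right_distributive grmul +%R.
Proof.
move=> z x y.
rewrite (grmulw (fsubset_refl _) (msuppD_le x y)).
rewrite (grmulw (fsubset_refl (msupp z)) (fsubsetUl _ (msupp y))).
rewrite (grmulw (fsubset_refl (msupp z)) (fsubsetUr (msupp x) _)).
rewrite -big_split /=; apply/eq_bigr=> g _.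
rewrite -big_split /=; apply/eq_bigr=> h _.
by rewrite mcoeffD mulrDr monalgUD.
Qed.

Lemma grmulUU a b g h :
  grmul << a *g g >> << b *g h >> = << a * b *g (g * h)%g >>.
Proof. by rewrite (grmulw msuppU_le msuppU_le) !big_seq_fset1 !mcoeffUU. Qed.

Lemma grmul_suml (I : Type) (s : seq I) (F : I -> {malg R[G]}) y :
  grmul (\sum_(i <- s) F i) y = \sum_(i <- s) grmul (F i) y.
Proof.
exact: (big_morph (grmul^~ y) (fun u v => grmulDl u v y) (grmul0l y)).
Qed.

Lemma grmul_sumr (I : Type) (s : seq I) (F : I -> {malg R[G]}) y :
  grmul y (\sum_(i <- s) F i) = \sum_(i <- s) grmul y (F i).
Proof. exact: (big_morph (grmul y) (grmulDr y) (grmul0r y)). Qed.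

Lemma grmul1l : left_id grone grmul.
Proof.
move=> x; rewrite [x in LHS]monalgE grmul_sumr [RHS]monalgE.
by apply/eq_bigr=> g _; rewrite grmulUU mul1r mul1g.
Qed.

Lemma grmul1r : right_id grone grmul.
Proof.
move=> x; rewrite [x in LHS]monalgE grmul_suml [RHS]monalgE.
by apply/eq_bigr=> g _; rewrite grmulUU mulr1 mulg1.
Qed.

Lemma grmulA : associative grmul.
Proof.
move=> x y z; rewrite [x]monalgE !grmul_suml; apply/eq_bigr=> g _.
rewrite [y]monalgE grmul_sumr !grmul_suml grmul_sumr; apply/eq_bigr=> h _.
rewrite [z]monalgE !grmul_sumr; apply/eq_bigr=> k _.
by rewrite !grmulUU mulrA mulgA.
Qed.

Lemma grone_neq0 : grone != 0.
Proof. by rewrite monalgU_eq0 oner_eq0. Qed.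

End GroupRing.

HB.instance Definition _ (R : nzRingType) (G : groupType) :=
  GRing.Zmodule_isNzRing.Build (group_ring R G) (@grmulA R G) (@grmul1l R G)
    (@grmul1r R G) (@grmulDl R G) (@grmulDr R G) (@grone_neq0 R G).

(* Main.v *)
Require Import Defs.
From HB Require Import structures.
From mathcomp Require Import all_boot all_order all_algebra.
From mathcomp Require Import finmap.
From mathcomp.multinomials Require Import monalg.

(* A ring morphism f from a sqrtDelta-fine ring A to a nonzero ring is
   injective.  If r <> 0 and f r = 0, write r = u + a with u a unit and a ^+ m
   in Delta; then f (a ^+ m) = f ((- u) ^+ m), so for v the inverse of
   (- u) ^+ m the unit 1 - v * a ^+ m is sent to 0, which is absurd.  Applied
   to the augmentation RG -> R, this forces G to be trivial, in which case the
   augmentation is an isomorphism. *)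

Set Implicit Arguments.
Unset Strict Implicit.
Unset Printing Implicit Defensive.

Import GRing.Theory.
Local Open Scope ring_scope.

Section Units.
Variable A : pzRingType.
Implicit Types u : A.

Lemma is_unitN u : is_unit u -> is_unit (- u).
Proof. by case=> v [uv vu]; exists (- v); rewrite !mulrNN. Qed.

Lemma is_unitX u n : is_unit u -> is_unit (u ^+ n).
Proof.
case=> v [uv vu]; exists (v ^+ n).
have cuv : GRing.comm u v by rewrite /GRing.comm uv vu.
by rewrite -!exprMn_comm // ?uv ?vu ?expr1n.
Qed.

End Units.

Lemma rmorph_is_unit (A B : pzRingType) (f : {rmorphism A -> B}) u :
  is_unit u -> is_unit (f u).
Proof.
by case=> v [uv vu]; exists (f v); rewrite -!rmorphM uv vu rmorph1.
Qed.

Lemma is_unit_neq0 (A : nzRingType) (u : A) : is_unit u -> u <> 0.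
Proof.
by case=> v [uv _] u0; move/eqP: uv; rewrite u0 mul0r eq_sym oner_eq0.
Qed.

Lemma sqrtDelta_fine_rmorph_inj (A : pzRingType) (B : nzRingType)
    (f : {rmorphism A -> B}) : sqrtDelta_fine A -> injective f.
Proof.
move=> fineA; apply: raddf_inj => r fr0; apply/eqP/negPn/negP => /eqP r0.
have [_ [u [a [Uu [m [_ Dam]] def_r]]]] := fineA r r0.
have [v [vu uv]] := is_unitX m (is_unitN Uu).
have Uv : is_unit v by exists ((- u) ^+ m).
apply: (is_unit_neq0 (rmorph_is_unit f (Dam v Uv))).
(* Here [a = - u + r], and [f] kills [r]. *)
have fa : f a = f (- u) by rewrite -[a](addKr u) -def_r rmorphD fr0 addr0.
by rewrite rmorphB rmorphM rmorphXn fa -rmorphXn -rmorphM uv subrr.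
Qed.

Section Retract.
Variables (A B : pzRingType) (f : {rmorphism A -> B}) (g : {rmorphism B -> A}).
Hypothesis gK : cancel g f.

(** A unit [u] of [B] lifts to the unit [g u] of [A], and [1 - u * f a] is the image under [f] of
    [1 - g u * a]. Surjectivity of [f] alone would not lift units to units. *)
Lemma Delta_retract a : Delta a -> Delta (f a).
Proof.
move=> Da u Uu; rewrite -[u]gK -rmorphM -(rmorph1 f) -rmorphB.
by apply/rmorph_is_unit/Da/rmorph_is_unit.
Qed.

(** The map [f] carries a decomposition of [g r] in [A] to one of [f (g r) = r]. Both directions of
    the theorem rest on this. *)
Lemma sqrtDelta_fine_retract : sqrtDelta_fine A -> sqrtDelta_fine B.
Proof.
move=> fineA r r0; split=> //.
have gr0 : g r <> 0 by move=> gr0; apply: r0; rewrite -[r]gK gr0 rmorph0.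
have [_ [u [a [Uu [m [m1 Dam]] def_gr]]]] := fineA _ gr0.
exists (f u), (f a); split; last by rewrite -rmorphD -def_gr gK.
  exact: rmorph_is_unit.
by exists m; split; rewrite // -rmorphXn; apply: Delta_retract.
Qed.

End Retract.

Section Augmentation.
Variables (R : nzRingType) (G : groupType).
Implicit Types (x y : group_ring R G) (a : R) (g : G).

Definition augmentation x : R := mmap (@idfun R) (fun _ : G => 1) x.

Lemma augmentationU a g : augmentation << a *g g >> = a.
Proof. by rewrite /augmentation mmapU mulr1. Qed.

Lemma augmentationE x : augmentation x = \sum_(g <- msupp x) x@_g.
Proof.
by rewrite /augmentation mmapE; apply: eq_bigr => g _; rewrite mulr1.
Qed.

Lemma augmentation_is_zmod_morphism : zmod_morphism augmentation.
Proof. by move=> x y; rewrite /augmentation -mmapB. Qed.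

HB.instance Definition _ := GRing.isZmodMorphism.Build (group_ring R G) R
  augmentation augmentation_is_zmod_morphism.

Lemma augmentation_is_monoid_morphism : monoid_morphism augmentation.
Proof.
split=> [|x y]; first exact: augmentationU.
(* Both sides become double sums over the two supports; they agree term by term, since a monomial is
   sent to its coefficient. *)
rewrite [x * y]/(grmul x y) /grmul (raddf_sum augmentation).
rewrite (augmentationE x) (augmentationE y) mulr_suml; apply: eq_bigr => g _.
rewrite (raddf_sum augmentation) mulr_sumr; apply: eq_bigr => h _.
exact: augmentationU.
Qed.

HB.instance Definition _ := GRing.isMonoidMorphism.Build (group_ring R G) R
  augmentation augmentation_is_monoid_morphism.

Definition gr_const a : group_ring R G := << a *g 1%g >>.

Lemma gr_const_is_zmod_morphism : zmod_morphism gr_const.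
Proof. by move=> a b; rewrite /gr_const monalgUB. Qed.

HB.instance Definition _ := GRing.isZmodMorphism.Build R (group_ring R G)
  gr_const gr_const_is_zmod_morphism.

Lemma gr_const_is_monoid_morphism : monoid_morphism gr_const.
Proof.
split=> // a b.
by apply/esym/(etrans (grmulUU a b 1%g 1%g)); rewrite mulg1.
Qed.

HB.instance Definition _ := GRing.isMonoidMorphism.Build R (group_ring R G)
  gr_const gr_const_is_monoid_morphism.

Lemma gr_constK : cancel gr_const augmentation.
Proof. by move=> a; exact: augmentationU. Qed.

(** For trivial [G], every monomial in the expansion of [x] sits at the identity and is therefore a
    constant. *)
Lemma augmentationK : (forall g, g = 1%g) -> cancel augmentation gr_const.
Proof.
move=> G1 x; rewrite augmentationE (raddf_sum gr_const) [RHS]monalgE.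
by apply: eq_bigr => g _; rewrite /gr_const (G1 g).
Qed.

(** The monomials with coefficient 1 at [g] and at the identity both have augmentation 1, so
    injectivity identifies them. *)
Lemma augmentation_inj_trivg : injective augmentation -> forall g, g = 1%g.
Proof.
move=> inj_aug g.
have /(congr1 (mcoeff g)) : << 1 *g g >> = << 1 *g 1%g >> :> {malg R[G]}.
  by apply: inj_aug; rewrite !augmentationU.
(* If [g] were not the identity, the coefficients at [g] would give [1 = 0] in the nonzero ring
   [R]. *)
rewrite mcoeffUU mcoeffU; case: eqP => [-> //|_ /eqP].
by rewrite mulr0n oner_eq0.
Qed.

End Augmentation.

Theorem lemma4p1 (R : nzRingType) (G : groupType) :
  sqrtDelta_fine (group_ring R G) <->
  sqrtDelta_fine R /\ (forall g : G, g = 1%g).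
Proof.
split=> [fineRG | [fineR G1]].
  have G1 : forall g : G, g = 1%g.
    apply: (@augmentation_inj_trivg R G).
    exact: sqrtDelta_fine_rmorph_inj fineRG.
  split=> //.
  exact: (sqrtDelta_fine_retract (@gr_constK R G) fineRG).
(* The roles are exchanged: [gr_const] is now the retraction and [augmentation] its section. *)
exact: (sqrtDelta_fine_retract (augmentationK G1) fineR).
Qed.
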